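(* Let $n, b$ be positive integers and $d = nb$. Let $R \in \mathbb{R}^{b \times b}$ be a normalized Hadamard matrix and let $\tilde{R} = I_n \otimes R \in \mathbb{R}^{d \times d}$ be the corresponding block rotation. Let $X \in \mathbb{R}^d$ be a row vector and, for $j \in [n]$, let $X_{\{j\}} \in \mathbb{R}^b$ be the $j$-th block of $X$. Define $\delta_{\{j\}} = \Vert X_{\{j\}} \Vert_1 / \left( b \Vert X_{\{j\}} \Vert_\infty \right)$ for $j \in [n]$. Then $$\Vert X \tilde{R} \Vert_\infty \leq \max_{j \in [n]} \; \delta_{\{j\}} \sqrt{b} \, \Vert X_{\{j\}} \Vert_\infty .$$
   Context: $[n] = \{1,\dots,n\}$. A normalized Hadamard matrix $R \in \mathbb{R}^{k \times k}$ is an orthogonal matrix all of whose entries are $\pm 1/\sqrt{k}$; in particular each column $R_i$ satisfies $\Vert R_i\Vert_2 = 1$ and $\Vert R_i \Vert_\infty = 1/\sqrt{k}$. $I_n$ is the $n \times n$ identity matrix and $\otimes$ is the Kronecker product, so $I_n \otimes R = \mathrm{diag}(R,\ldots,R)$ is block diagonal with $n$ copies of $R$. For $X = (X_1,\dots,X_d)$ with $d = nb$, the $j$-th block consists of $b$ consecutive coordinates: $X_{\{j\}} = (X_{(j-1)b+1}, \dots, X_{jb})$. Vectors are row vectors, and $\Vert\cdot\Vert_1$, $\Vert\cdot\Vert_\infty$ are the usual vector norms. Convention: if $X_{\{j\}} = 0$, the ratio $\delta_{\{j\}}$ is taken to be $0$. *)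

(* Defs.v *)
From mathcomp Require Import all_boot all_order all_algebra.
From mathcomp Require Import reals normedtype.
From mathcomp Require Import mxtens.

Set Implicit Arguments.
Unset Strict Implicit.
Unset Printing Implicit Defensive.

Import Order.TTheory GRing.Theory Num.Theory.
Local Open Scope ring_scope.

(* The infinity norm is the library norm `|x| on matrices (the maximum of the
   absolute values of the entries, see mx_normrE); the library has no 1-norm. *)
Definition norm1 (R : realType) (b : nat) (x : 'rV[R]_b) : R :=
  \sum_(i < b) `|x ord0 i|.

Definition orthogonal_mx (R : realType) (k : nat) (A : 'M[R]_k) : Prop :=
  A *m A^T = 1%:M.

Definition normalized_hadamard (R : realType) (k : nat) (A : 'M[R]_k) : Prop :=
  orthogonal_mx A /\
  forall i j : 'I_k,
    A i j = 1 / Num.sqrt k%:R \/ A i j = - (1 / Num.sqrt k%:R).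

(* [_ *t _] is the Kronecker product of mxtens. *)
Definition block_rotation (R : realType) (n b : nat) (A : 'M[R]_b) :
    'M[R]_(n * b) :=
  (1%:M : 'M[R]_n) *t A.

(* [mxtens_index (j, i)] is the index with value j * b + i. *)
Definition block (R : realType) (n b : nat) (X : 'rV[R]_(n * b)) (j : 'I_n) :
    'rV[R]_b :=
  \row_(i < b) X ord0 (mxtens_index (j, i)).

(* For a zero block this is 0 / 0, which is 0 in MathComp, as intended. *)
Definition delta (R : realType) (n b : nat) (X : 'rV[R]_(n * b)) (j : 'I_n) :
    R :=
  norm1 (block X j) / (b%:R * `|block X j|).

(* Main.v *)
(* Column i of block j of X *m block_rotation n H is column i of X_{j} H, a
   signed sum of the entries of X_{j} divided by sqrt b; it is therefore at most
   norm1 X_{j} / sqrt b, which equals delta_{j} sqrt b `|X_{j}|. *)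
Require Import Defs.
From mathcomp Require Import all_boot all_order all_algebra.
From mathcomp Require Import reals normedtype.
From mathcomp Require Import mxtens.
From mathcomp Require Import ring.

Set Implicit Arguments.
Unset Strict Implicit.
Unset Printing Implicit Defensive.

Import Order.TTheory GRing.Theory Num.Theory.
Local Open Scope ring_scope.

(** With the sum indexed by pairs [(k, l)], the identity factor [1%:M k j] kills every block except
    [k = j]. *)
Lemma mulmx_block_rotation (R : realType) (n b : nat) (A : 'M[R]_b)
    (X : 'rV[R]_(n * b)) (j : 'I_n) (i : 'I_b) :
  (X *m block_rotation n A) ord0 (mxtens_index (j, i)) =
    (block X j *m A) ord0 i.
Proof.
rewrite !mxE (reindex (@mxtens_index n b)) /=; last first.
  by exists (@mxtens_unindex n b) => k _;
    [exact: mxtens_indexK | exact: mxtens_unindexK].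
transitivity (\sum_(k < n) \sum_(l < b)
    X ord0 (mxtens_index (k, l)) * ((1%:M : 'M[R]_n) k j * A l i)).
  by rewrite pair_bigA; apply: eq_bigr => -[k l] _; rewrite tensmxE.
rewrite (bigD1 j) //= [X in _ + X]big1 ?addr0 => [|k /negPf k_neq_j].
  by apply: eq_bigr => l _; rewrite !mxE eqxx mul1r.
by rewrite big1 // => l _; rewrite mxE k_neq_j mul0r mulr0.
Qed.

Lemma normalized_hadamard_normr (R : realType) (k : nat) (H : 'M[R]_k)
    (hadamardH : normalized_hadamard H) (i j : 'I_k) :
  `|H i j| = (Num.sqrt k%:R)^-1.
Proof.
by case: hadamardH => _ /(_ i j)[] ->;
  rewrite ?normrN div1r ger0_norm ?invr_ge0 ?sqrtr_ge0.
Qed.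

(** Triangle inequality, every entry of [H] having modulus [1 / sqrt b]. *)
Lemma mulmx_hadamard_le_norm1 (R : realType) (b : nat) (H : 'M[R]_b)
    (hadamardH : normalized_hadamard H) (x : 'rV[R]_b) (i : 'I_b) :
  `|(x *m H) ord0 i| <= norm1 x / Num.sqrt b%:R.
Proof.
rewrite mxE (le_trans (ler_norm_sum _ _ _)) // /norm1 mulr_suml.
by apply: ler_sum => k _; rewrite normrM normalized_hadamard_normr.
Qed.

Lemma norm1_0 (R : realType) (b : nat) : norm1 (0 : 'rV[R]_b) = 0.
Proof. by rewrite /norm1 big1 // => i _; rewrite mxE normr0. Qed.

Lemma delta_sqrt_norm (R : realType) (n b : nat) (b_gt0 : (0 < b)%N)
    (X : 'rV[R]_(n * b)) (j : 'I_n) :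
  delta X j * Num.sqrt b%:R * `|block X j| = norm1 (block X j) / Num.sqrt b%:R.
Proof.
have [Xj0|Xj_neq0] := eqVneq (block X j) 0.
  by rewrite /delta Xj0 norm1_0 !mul0r.
have sb_neq0 : Num.sqrt b%:R != 0 :> R by rewrite gt_eqF ?sqrtr_gt0 ?ltr0n.
have nXj_neq0 : `|block X j| != 0 by rewrite normr_eq0.
(* Writing [b] as the square of [sqrt b] leaves an identity of rational functions in [sqrt b]. *)
rewrite /delta -[in b%:R * _](@sqr_sqrtr R b%:R) ?ler0n //.
by field; rewrite sb_neq0.
Qed.

(* The terms of the maximum are nonnegative and n > 0, so the base value 0 of
   the iterated maximum does not affect it. *)
Theorem proposition3p2 (R : realType) (n b : nat) (n_gt0 : (0 < n)%N)
    (b_gt0 : (0 < b)%N) (H : 'M[R]_b) (hadamardH : normalized_hadamard H)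
    (X : 'rV[R]_(n * b)) :
  `|X *m block_rotation n H| <=
    \big[Num.max/0]_(j < n) (delta X j * Num.sqrt b%:R * `|block X j|).
Proof.
(* The norm becomes a maximum of entries with base value 0, so 0 and each entry must be bounded. *)
rewrite [leLHS]/Num.norm /= mx_normrE.
apply: bigmax_le => [|[i0 k] _ /=]; first exact: bigmax_ge_id.
rewrite [i0]ord1; case: (mxtens_indexP k) => j i.
(* An entry in block [j] is compared with the [j]-th term. *)
rewrite mulmx_block_rotation (le_trans _ (le_bigmax _ _ j)) //.
by rewrite delta_sqrt_norm // mulmx_hadamard_le_norm1.
Qed.
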